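(* Let $L=\mathfrak{k}\oplus\mathfrak{p}$ be a Cartan decomposition of a real semisimple Lie algebra $L$ (where $\mathfrak{k}$ is a maximal compact Lie subalgebra) such that $L$ is non-Hermitian of full rank, that is, $\mathfrak{k}$ is semisimple and $\mathrm{rank}(\mathfrak{k})=\mathrm{rank}(L)$. Let $a$ be a regular element of $\mathfrak{k}$. Then there exists a regular element $b$ in $\mathfrak{k}$ such that $L=[a,L]+[b,L]$ and $a,b$ are orthogonal with respect to the Killing form of $L$.
   Context: An element of a semisimple Lie algebra is regular if it is semisimple and its centralizer in that Lie algebra is a Cartan subalgebra of that Lie algebra. The rank of a semisimple Lie algebra is the dimension of its Cartan subalgebras. Here $[a,L]=\{[a,y]:y\in L\}$. *)

(* Defs.v *)
From HB Require Import structures.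
From mathcomp Require Import all_boot all_order all_algebra.
From mathcomp Require Import boolp classical_sets reals.
Set Implicit Arguments.
Unset Strict Implicit.
Unset Printing Implicit Defensive.
Import Order.TTheory GRing.Theory Num.Theory.
Local Open Scope ring_scope.

HB.mixin Record Vector_isLieAlgebra (F : fieldType) L of Vector F L := {
  lie : L -> L -> L;
  lie_linearl : forall y : L, linear (lie^~ y);
  lie_linearr : forall x : L, linear (lie x);
  liexx : forall x : L, lie x x = 0;
  lie_jacobi : forall x y z : L,
    lie x (lie y z) + lie y (lie z x) + lie z (lie x y) = 0
}.

#[short(type="lieAlgType")]
HB.structure Definition LieAlgebra (F : fieldType) :=
  { L of Vector_isLieAlgebra F L & Vector F L }.

HB.instance Definition _ (F : fieldType) (L : lieAlgType F) (x : L) :=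
  GRing.isLinear.Build F L L *:%R (lie x) (@lie_linearr F L x).

Definition ad (F : fieldType) (L : lieAlgType F) (x : L) : 'End(L) :=
  linfun (lie x).

Lemma adE (F : fieldType) (L : lieAlgType F) (x y : L) : ad x y = lie x y.
Proof. by rewrite lfunE. Qed.

Definition lfun_trace (F : fieldType) (V : vectType F) (f : 'End(V)) : F :=
  \tr (passmx.mxof (vbasis fullv) (vbasis fullv) f).

Definition killing (F : fieldType) (L : lieAlgType F) (x y : L) : F :=
  lfun_trace (ad x \o ad y)%VF.

(* [U, V]; by bilinearity, brackets of basis vectors suffice. *)
Definition lie_prod (F : fieldType) (L : lieAlgType F) (U V : {vspace L}) :
    {vspace L} :=
  <<[seq lie x y | x <- vbasis U, y <- vbasis V]>>%VS.

Lemma mem_lie_prod (F : fieldType) (L : lieAlgType F) (U V : {vspace L})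
    (x y : L) : x \in U -> y \in V -> lie x y \in lie_prod U V.
Proof.
move=> Ux Vy.
pose h z := GRing.isLinear.Build F L L *:%R (lie^~ z) (@lie_linearl F L z).
pose g z : {linear L -> L} := HB.pack (lie^~ z) (h z).
rewrite (coord_vbasis Vy) linear_sum memv_suml // => j _.
rewrite linearZ memvZ //= -[lie x _]/(g _ x) (coord_vbasis Ux) linear_sum.
rewrite memv_suml // => i _; rewrite linearZ memvZ // memv_span //.
by apply: allpairs_f; rewrite mem_nth // size_tuple.
Qed.

(* Below, the Lie subalgebras g of L (including L itself, as fullv) are
   treated as Lie algebras in their own right. *)

Definition lie_subalgebra (F : fieldType) (L : lieAlgType F)
    (g : {vspace L}) : Prop :=
  forall x y : L, x \in g -> y \in g -> lie x y \in g.

Definition lie_ideal (F : fieldType) (L : lieAlgType F)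
    (g I : {vspace L}) : Prop :=
  (I <= g)%VS /\ forall x y : L, x \in g -> y \in I -> lie x y \in I.

Definition lie_solvable (F : fieldType) (L : lieAlgType F)
    (g : {vspace L}) : Prop :=
  exists n : nat, iter n (fun U => lie_prod U U) g = 0%VS.

Definition lie_nilpotent (F : fieldType) (L : lieAlgType F)
    (g : {vspace L}) : Prop :=
  exists n : nat, iter n (lie_prod g) g = 0%VS.

Definition lie_semisimple (F : fieldType) (L : lieAlgType F)
    (g : {vspace L}) : Prop :=
  lie_subalgebra g /\
  forall I : {vspace L}, lie_ideal g I -> lie_solvable I -> I = 0%VS.

Definition self_normalizing (F : fieldType) (L : lieAlgType F)
    (g h : {vspace L}) : Prop :=
  forall x : L, x \in g -> (forall y : L, y \in h -> lie x y \in h) -> x \in h.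

Definition cartan_subalgebra (F : fieldType) (L : lieAlgType F)
    (g h : {vspace L}) : Prop :=
  [/\ (h <= g)%VS, lie_subalgebra h, lie_nilpotent h & self_normalizing g h].

(* 0 is the value when g has no Cartan subalgebra, which does not happen over
   an infinite field; in characteristic 0 all Cartan subalgebras of g have the
   same dimension. *)
Definition lie_rank (F : fieldType) (L : lieAlgType F) (g : {vspace L}) : nat :=
  xget 0%N [set n | exists2 h : {vspace L}, cartan_subalgebra g h & \dim h = n].

Definition lie_centralizer (F : fieldType) (L : lieAlgType F)
    (g : {vspace L}) (x : L) : {vspace L} :=
  (g :&: lker (ad x))%VS.

(* f restricts to a semisimple endomorphism of U (over a perfect field:
   diagonalizable over the algebraic closure). *)
Definition semisimple_on (F : fieldType) (V : vectType F)
    (U : {vspace V}) (f : 'End(V)) : Prop :=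
  (f @: U <= U)%VS /\
  forall W : {vspace V}, (W <= U)%VS -> (f @: W <= W)%VS ->
    exists W' : {vspace V},
      [/\ (f @: W' <= W')%VS, (W + W')%VS = U & (W :&: W')%VS = 0%VS].

Definition semisimple_element (F : fieldType) (L : lieAlgType F)
    (g : {vspace L}) (x : L) : Prop :=
  x \in g /\ semisimple_on g (ad x).

Definition regular_element (F : fieldType) (L : lieAlgType F)
    (g : {vspace L}) (x : L) : Prop :=
  semisimple_element g x /\ cartan_subalgebra g (lie_centralizer g x).

(* k is the compact part; for L semisimple it is then automatically a maximal
   compact subalgebra, and p is its Killing-orthogonal complement. *)
Definition cartan_decomposition (R : realType) (L : lieAlgType R)
    (k p : {vspace L}) : Prop :=
  [/\ (k + p)%VS = fullv /\ (k :&: p)%VS = 0%VS,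
      [/\ forall x y : L, x \in k -> y \in k -> lie x y \in k,
          forall x y : L, x \in k -> y \in p -> lie x y \in p &
          forall x y : L, x \in p -> y \in p -> lie x y \in k],
      forall x : L, x \in k -> x != 0 -> killing x x < 0 &
      forall x : L, x \in p -> x != 0 -> 0 < killing x x].

(* Main.v *)
Require Import Defs.
From HB Require Import structures.
From mathcomp Require Import all_boot all_order all_algebra.
From mathcomp Require Import boolp classical_sets reals.
Set Implicit Arguments.
Unset Strict Implicit.
Unset Printing Implicit Defensive.
Import Order.TTheory GRing.Theory Num.Theory.
Local Open Scope ring_scope.

(** Write [B] for the Killing form, [C(x)] for the centralizer of [x] in [L]
    and [t] for the Cartan subalgebra [C(a) :&: k] of [k]. The element [b] is
    taken generic in the hyperplane [V] of [k] orthogonal to [a]: among the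
    elements of [V] it maximizes the rank of [ad b], and [C(b) :&: t = 0].
    Both requirements hold outside a proper algebraic subset of [V], so it
    suffices to satisfy them one at a time and to move along a segment
    ([rank_segment]). The second one is met inside [[a, k]] because [k] has
    trivial center ([transversal_in_range]).

    Maximality of the rank has a first order consequence: for [z] in [V], [ad
    z] maps [C(b)] into the range of [ad b] ([rank_jump]), which by invariance
    of [B] says that [z] is orthogonal to [[C(b), C(b)]]. Hence the part of
    [[C(b), C(b)]] that lies in [k] is contained in the line of [a]; as it
    also lies in [C(b)], and [a] is in [t], it vanishes
    ([centralizer_bracket]). It follows that [t' = C(b) :&: k] is abelian, so
    that [b] is regular in [k], and, [B] being definite on [p], that [C(b) :&:
    p] commutes with [t'].

    The rank condition now forces [C(b) :&: p = 0]. Otherwise every element of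
    [C(b)] annihilates a subspace of dimension larger than [\dim t']. The
    elements of [C(b)] near [b] meet all the nearby orbits of the adjoint
    group, because [L = C(b) + [b, L]]; a characteristic polynomial is
    constant on orbits, so the eigenvalue 0 of [ad y] has multiplicity larger
    than [\dim t'] for every [y] in [L]. In contrast, a Cartan subalgebra of
    [L] contains elements for which that multiplicity is its own dimension
    ([cartan_complement]). The same comparison inside [k] shows that [\dim t']
    is at least the rank of [k], which is the rank of [L]: a contradiction.
    The orbit argument is made algebraic in [nullity_propagates] and carried
    to Lie algebras in [nullity_le].

    Finally [[a, L] + [b, L]] is the [B]-orthogonal of [C(a) :&: C(b)], which
    is contained in [t :&: C(b) = 0]. *)

(** * Vanishing of polynomials and derivative of a determinant *)

Lemma exists_nonroot (R : numDomainType) (p : {poly R}) :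
  p != 0 -> exists2 s : R, s != 0 & p.[s] != 0.
Proof.
move=> p0; pose rs : seq R := [seq i.+1%:R | i <- iota 0 (size p)].
have urs : uniq rs.
  by rewrite map_inj_uniq ?iota_uniq // => i j /eqP; rewrite eqr_nat => /eqP [].
have /allPn [_ /mapP [i _ ->] rp] : ~~ all (root p) rs.
  apply/negP => allp; have := max_poly_roots p0 allp urs.
  by rewrite size_map size_iota ltnn.
by exists i.+1%:R => //; rewrite pnatr_eq0.
Qed.

Lemma poly_eq0_of_eval (R : numDomainType) (p : {poly R}) :
  (forall s, p.[s] = 0) -> p = 0.
Proof.
move=> p0; apply/eqP; apply: contraT => /exists_nonroot [s _].
by rewrite p0 eqxx.
Qed.

Lemma deriv_eq0_const (R : numDomainType) (p : {poly R}) :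
  p^`() = 0 -> p = (p`_0)%:P.
Proof.
move=> p'0; apply: size1_polyC; apply/leq_sizeP => -[//|i] _.
have := congr1 (fun q : {poly R} => q`_i) p'0.
by rewrite coef_deriv coef0 => /eqP; rewrite mulrn_eq0 /= => /eqP.
Qed.

Lemma deriv_prod (R : comNzRingType) (I : eqType) (r : seq I)
    (F : I -> {poly R}) : uniq r ->
  (\prod_(i <- r) F i)^`() =
    \sum_(i <- r) (F i)^`() * \prod_(j <- r | j != i) F j.
Proof.
elim: r => [|i r IHr] /=; first by rewrite !big_nil derivC.
case/andP=> ir ur; rewrite !big_cons derivM IHr // eqxx /=; congr (_ * _ + _).
  by rewrite big_seq_cond [in RHS]big_seq_cond; apply: eq_bigl => j;
    rewrite andbT andbC; case: eqP => //= ->; rewrite (negPf ir).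
rewrite mulr_sumr; apply: eq_big_seq => j jr.
rewrite big_cons; case: eqP => [ij|_]; last by rewrite /= mulrCA.
by rewrite ij jr in ir.
Qed.

(** Jacobi's formula.  The determinant is linear in each row, and the minors
    along a row are the entries of the adjugate. *)
Lemma deriv_det (R : comNzRingType) n (M : 'M[{poly R}]_n) :
  (\det M)^`() = \tr (\adj M *m map_mx (@deriv R) M).
Proof.
pose D i := \matrix_(k, j) (if k == i then (M k j)^`() else M k j).
transitivity (\sum_i \det (D i)).
  rewrite /determinant raddf_sum exchange_big; apply: eq_bigr => /= s _.
  have -> (b : bool) (p : {poly R}) : ((-1) ^+ b * p)^`() = (-1) ^+ b * p^`().
    by case: b; rewrite ?expr1 ?mulN1r ?derivN ?expr0 ?mul1r.
  rewrite deriv_prod ?index_enum_uniq // mulr_sumr; apply: eq_bigr => i _.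
  congr (_ * _); rewrite [RHS](bigD1 i) //= mxE eqxx; congr (_ * _).
  by apply: eq_bigr => j /negPf ji; rewrite mxE ji.
rewrite mxtrace_mulC; apply: eq_bigr => i _.
rewrite mxE (expand_det_row _ i); apply: eq_bigr => j _.
rewrite !mxE eqxx; congr (_ * _); rewrite /cofactor; congr (_ * \det _).
by apply/matrixP => k l; rewrite !mxE eq_sym (negPf (neq_lift _ _)).
Qed.

(** * Propagation of a common multiplicity of the eigenvalue zero *)

(** Infinitesimal invariance of the determinant under conjugation: by
    [deriv_det], the left-hand side is its derivative at [M] in the direction of
    the commutator. *)
Lemma mxtrace_adj_commutator (R : comNzRingType) n (M W : 'M[R]_n) :
  \tr (\adj M *m (W *m M - M *m W)) = 0.
Proof.
rewrite mulmxBr raddfB /= mxtrace_mulC -mulmxA mul_mx_adj mulmxA mul_adj_mx.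
by rewrite mul_mx_scalar mul_scalar_mx subrr.
Qed.

Lemma commutatorB (R : pzRingType) n (W A B : 'M[R]_n) :
  W *m (A - B) - (A - B) *m W =
    (W *m A - A *m W) - (W *m B - B *m W).
Proof. by rewrite mulmxBr mulmxBl !opprD !opprK addrACA. Qed.

Section MapPolyAdditive.

Variables (A R : comNzRingType) (iota : {rmorphism R -> A}).
Variable phi : {additive A -> R}.

Lemma deriv_map_additive (P : {poly A}) :
  (map_poly phi P)^`() = map_poly phi P^`().
Proof.
apply/polyP => i; rewrite coef_deriv !coef_map_id0 ?raddf0 //.
by rewrite coef_deriv raddfMn.
Qed.

Hypothesis phiM : forall a r, phi (a * iota r) = phi a * r.

Lemma horner_map_additive (P : {poly A}) r :
  (map_poly phi P).[r] = phi P.[iota r].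
Proof.
elim/poly_ind: P => [|P c IHP]; first by rewrite raddf0 !horner0 raddf0.
rewrite hornerMXaddC [RHS]raddfD phiM -IHP.
have -> : map_poly phi (P * 'X + c%:P) = map_poly phi P * 'X + (phi c)%:P.
  apply/polyP => i; rewrite coef_map_id0 ?raddf0 // !coefD !coefMX !coefC.
  by rewrite raddfD /= coef_map_id0 ?raddf0 //; case: eqP; rewrite ?raddf0.
by rewrite hornerMXaddC.
Qed.

End MapPolyAdditive.

Section NullityPropagation.

Variables (R : numDomainType) (n : nat) (X : 'M[R]_n).

Local Notation const2 Z := (map_mx polyC (map_mx polyC Z)).

(** The matrix [T - X - s Z], where [T] is the inner and [s] the outer
    indeterminate; its determinant is the characteristic polynomial along the
    line through [X] directed by [Z]. *)
Definition char_mx_line (Z : 'M[R]_n) : 'M[{poly {poly R}}]_n :=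
  map_mx polyC (char_poly_mx X) - 'X *: const2 Z.

(** Up to sign, the derivative of the determinant at [T - X - s Z] in the
    constant direction [Z']. *)
Definition char_line_deriv (Z Z' : 'M[R]_n) : {poly {poly R}} :=
  \tr (\adj (char_mx_line Z) *m const2 Z').

(** The commutator of [W] with [T - X - s Z] is a direction of derivative zero.
    The scalar [T] contributes nothing to it, so that the derivative in the
    direction [[W, X]] gains a factor [s]. *)
Lemma char_line_deriv_commutator Z W :
  char_line_deriv Z (W *m X - X *m W) =
    - ('X * char_line_deriv Z (W *m Z - Z *m W)).
Proof.
have comm := mxtrace_adj_commutator (char_mx_line Z) (const2 W).
apply/eqP; rewrite -addr_eq0 -mxtraceZ -raddfD /= scalemxAr -mulmxDr.
rewrite -oppr_eq0 -raddfN /= -mulmxN -[X in _ == X]comm; apply/eqP.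
congr (\tr (_ *m _)); rewrite /char_mx_line /char_poly_mx.
rewrite !map_mxB !commutatorB map_scalar_mx scalar_mxC subrr sub0r opprD.
by rewrite -scalemxAr -scalemxAl -scalerBr !map_mxM.
Qed.

Lemma char_mx_line_eval Z s :
  (map_mx (horner_eval s%:P) (char_mx_line Z)) = char_poly_mx (X + s *: Z).
Proof.
apply/matrixP => i j; rewrite !mxE /horner_eval.
by rewrite !hornerE polyCD polyCM opprD addrA.
Qed.

Lemma char_line_eval Z s :
  (\det (char_mx_line Z)).[s%:P] = char_poly (X + s *: Z).
Proof. by rewrite /char_poly -char_mx_line_eval det_map_mx. Qed.

(** The matrix [T - X - s (Z + e Z')], with a third and outermost indeterminate
    [e]. *)
Definition char_mx_plane (Z Z' : 'M[R]_n) : 'M[{poly {poly {poly R}}}]_n :=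
  map_mx polyC (char_mx_line Z) - 'X *: map_mx polyC ('X *: const2 Z').

Lemma char_mx_plane_eval Z Z' e :
  map_mx (horner_eval e%:P%:P) (char_mx_plane Z Z') =
    char_mx_line (Z + e *: Z').
Proof.
apply/matrixP => i j; rewrite !mxE /= /horner_eval.
rewrite !(hornerD, hornerN, hornerM, hornerX, hornerC).
rewrite (polyCD (Z i j)) (polyCD (Z i j)%:P) !polyCM.
by rewrite mulrDr opprD addrA mulrCA.
Qed.

Lemma char_plane_eval Z Z' e :
  (\det (char_mx_plane Z Z')).[e%:P%:P] = \det (char_mx_line (Z + e *: Z')).
Proof. by rewrite -char_mx_plane_eval det_map_mx. Qed.

Lemma char_plane_deriv_eval Z Z' e :
  (\det (char_mx_plane Z Z'))^`().[e%:P%:P] =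
    - ('X * char_line_deriv (Z + e *: Z') Z').
Proof.
rewrite deriv_det -[LHS]/(horner_eval _ _) -[LHS]trace_map_mx.
rewrite map_mxM map_mx_adj char_mx_plane_eval -mxtraceZ -raddfN /=.
rewrite scalemxAr -mulmxN.
congr (\tr (_ *m _)); apply/matrixP => i j; rewrite !mxE /= /horner_eval.
by rewrite !derivE !hornerE.
Qed.

(** An algebraic substitute for moving [X + Z] into [X + Q] by conjugation.
    One proves by induction on [m] that, for all [Z] in [S], the coefficients
    of degree less than [N] in [T] of [det (T - X - s Z)] vanish to order [m] in
    [s].
    Differentiating the hypothesis of induction in the direction [s Z'] shows
    that the derivatives vanish to order [m - 1], and to order [m] in the
    directions [[W, X]] by [char_line_deriv_commutator].  The coefficient of
    [s ^ m] is therefore unchanged when [Z] is translated by [[W, X]], which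
    brings [Z] into [Q], where everything vanishes. *)
Lemma nullity_propagates N (S Q : 'M[R]_n -> Prop) :
    (forall e Z Z', S Z -> S Z' -> S (Z + e *: Z')) ->
    (forall e U, Q U -> Q (e *: U)) -> S X ->
    (forall Z, S Z -> exists W, Q (Z - (W *m X - X *m W)) /\
       forall Z', S Z' -> S (W *m Z' - Z' *m W)) ->
    (forall U j, Q U -> (j < N)%N -> (char_poly (X + U))`_j = 0) ->
  forall Z j, S Z -> (j < N)%N -> (char_poly (X + Z))`_j = 0.
Proof.
move=> Slin Qlin SX Sdec Qnull.
pose F Z := \det (char_mx_line Z).
suff vanish m : forall Z i j, S Z -> (i < m)%N -> (j < N)%N -> (F Z)`_i`_j = 0.
  move=> Z j SZ jN; have := char_line_eval Z 1; rewrite scale1r => <-.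
  rewrite -/(F Z) horner_coef coef_sum big1 // => i _.
  by rewrite expr1n mulr1 (vanish i.+1).
(* The functional [coef2 i j] extracts the coefficient of [s ^ i * T ^ j].
   Applied coefficientwise to a polynomial in [e], it gives a polynomial over
   [R], which is zero as soon as it vanishes at all the points of [R]. *)
pose coef2 i j : {additive {poly {poly R}} -> R} := coefp j \o coefp i.
pose iota : {rmorphism R -> {poly {poly R}}} := polyC \o polyC.
have coef2M i j a r : coef2 i j (a * iota r) = coef2 i j a * r.
  by rewrite /coef2 /= /coefp !coefMC.
have evalE := horner_map_additive (coef2M _ _).
have base U i j : Q U -> (j < N)%N -> (F U)`_i`_j = 0.
  move=> QU jN; rewrite -[LHS]/(coefp j (F U)`_i) -coef_map_id0 ?raddf0 //.
  rewrite (@poly_eq0_of_eval _ (map_poly (coefp j) (F U))) ?coef0 // => s.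
  rewrite (@horner_map_additive _ _ polyC); last by move=> a r; exact: coefMC.
  by rewrite /= char_line_eval /coefp Qnull //; exact: Qlin.
elim: m => [//|m IHm].
have deriv_small Z Z' i j : S Z -> S Z' -> (i.+1 < m)%N -> (j < N)%N ->
    (char_line_deriv Z Z')`_i`_j = 0.
  move=> SZ SZ' im jN; pose P := \det (char_mx_plane Z Z').
  have P0 : map_poly (coef2 i.+1 j) P = 0.
    apply: poly_eq0_of_eval => e; rewrite evalE /P char_plane_eval.
    by rewrite /= /coefp IHm //; exact: Slin.
  have := congr1 (horner^~ 0) (congr1 (@deriv R) P0).
  rewrite deriv_map_additive derivC horner0 evalE char_plane_deriv_eval.
  rewrite scale0r addr0 raddfN /= => /eqP.
  by rewrite oppr_eq0 /coefp coefXM => /eqP.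
have deriv_comm Z W i j : S Z -> S (W *m X - X *m W) -> S (W *m Z - Z *m W) ->
    (i < m)%N -> (j < N)%N -> (char_line_deriv Z (W *m X - X *m W))`_i`_j = 0.
  move=> SZ SWX SWZ im jN; rewrite char_line_deriv_commutator !coefN coefXM.
  case: i im => [|i] im; first by rewrite coef0 oppr0.
  by rewrite deriv_small // oppr0.
move=> Z i j SZ; rewrite ltnS leq_eqVlt => /predU1P [-> jN|]; last exact: IHm.
have [W [QU SW]] := Sdec Z SZ.
set Z' := W *m X - X *m W in QU; set U := Z - Z' in QU.
have SZ' : S Z' by exact: SW.
have SU : S U by rewrite /U -scaleN1r; exact: Slin.
pose P := \det (char_mx_plane U Z').
have P'0 : (map_poly (coef2 m j) P)^`() = 0.
  apply: poly_eq0_of_eval => e; rewrite deriv_map_additive evalE.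
  rewrite char_plane_deriv_eval raddfN /= /coefp coefXM.
  case: m @P IHm deriv_small deriv_comm => [|m] P IHm deriv_small deriv_comm.
    by rewrite coef0 oppr0.
  by rewrite deriv_comm ?oppr0 //; do ?[exact: Slin | apply: SW].
have Fconst e : (F (U + e *: Z'))`_m`_j = (map_poly (coef2 m j) P)`_0.
  rewrite -[RHS](hornerC _ e) -(deriv_eq0_const P'0) evalE /P.
  by rewrite char_plane_eval.
have := Fconst 0; rewrite -(Fconst 1) scale0r scale1r addr0 subrK => <-.
exact: base.
Qed.

End NullityPropagation.

(** * Characteristic polynomial in the presence of a nilpotent block *)

Lemma char_poly_similar (F : fieldType) n (Q A B : 'M[F]_n) :
  Q \in unitmx -> Q *m A = B *m Q -> char_poly A = char_poly B.
Proof.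
move=> Qu QA; rewrite /char_poly /char_poly_mx.
have e : map_mx polyC Q *m ('X%:M - map_mx polyC A) =
         ('X%:M - map_mx polyC B) *m map_mx polyC Q.
  by rewrite mulmxBr mulmxBl -!map_mxM QA mul_mx_scalar mul_scalar_mx.
have := congr1 determinant e; rewrite !det_mulmx mulrC => /mulIf; apply.
by rewrite det_map_mx polyC_eq0 -unitfE -unitmxE.
Qed.

Lemma char_poly_lblock (R : comNzRingType) m d (A : 'M[R]_m) C (D : 'M[R]_d) :
  char_poly (block_mx A 0 C D) = char_poly A * char_poly D.
Proof.
rewrite /char_poly /char_poly_mx map_block_mx map_mx0 scalar_mx_block.
by rewrite opp_block_mx add_block_mx oppr0 addr0 det_lblock.
Qed.

(** [T - N] divides [T ^ k - N ^ k = T ^ k], whose determinant is a power of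
    [T]. *)
Lemma char_poly_nilpotent (F : fieldType) m (N : 'M[F]_m) k :
  N ^+ k = 0 -> char_poly N = 'X^m.
Proof.
move=> Nk0; pose X : 'M[{poly F}]_m := 'X%:M.
have dvd : char_poly N %| ('X - 0%:P) ^+ (k * m).
  have XN : GRing.comm X (map_mx polyC N) by apply/esym/scalar_mxC.
  have := congr1 determinant (subrXX_comm k XN).
  have -> : map_mx polyC N ^+ k = 0.
    have -> : map_mx polyC N ^+ k = map_mx polyC (N ^+ k).
      elim: k {Nk0} => [|k IH]; first by rewrite !expr0 [RHS]map_mx1.
      by rewrite !exprS IH [RHS]map_mxM.
    by rewrite Nk0 map_mx0.
  rewrite subr0 det_mulmx -/(char_poly N).
  have -> : X ^+ k = ('X ^+ k)%:M.
    elim: k {Nk0} => // k IH; rewrite !exprS IH.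
    exact: esym (scalar_mxM _ _ _).
  by rewrite det_scalar subr0 exprM => ->; exact: dvdp_mulr.
case/dvdp_exp_XsubCP: dvd => j _; rewrite subr0.
rewrite eqp_monic ?char_poly_monic ?monicXn // => /eqP Nj.
by have := size_char_poly N; rewrite Nj size_polyXn => -[->].
Qed.

(** In a basis whose first vectors span the rows of [U], the matrix [A] is block
    triangular.  Its first diagonal block is nilpotent, and a kernel vector of
    the second one would be annihilated by both [U] and [A]. *)
Lemma char_poly_factor (F : fieldType) m n (U : 'M[F]_(m, n)) (A : 'M[F]_n) k :
    row_free U -> (U *m A <= U)%MS -> U *m A ^+ k = 0 ->
  exists2 q : {poly F}, char_poly A = 'X^m * q &
    (row_full (col_mx U A) -> q`_0 != 0).
Proof.
move=> Ufree.
have [d dn] : exists d, n = (m + d)%N.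
  by exists (n - m)%N; rewrite subnKC // -(eqP Ufree) rank_leq_col.
subst n => Ustab UAk.
pose Q : 'M[F]_(m + d) := row_ebase U; pose E := col_ebase U.
have Qunit : Q \in unitmx by exact: row_ebase_unit.
have UE : U = E *m usubmx Q.
  rewrite -{1}(mulmx_ebase U) (eqP Ufree) -/E -/Q -mulmxA; congr (_ *m _).
  by rewrite -{1}(vsubmxK Q) pid_mx_row mul_row_col mul1mx mul0mx addr0.
have Eunit : E \in unitmx by exact: col_ebase_unit.
have QuE : usubmx Q = invmx E *m U by rewrite UE mulKmx.
have [N QuA] : exists N, usubmx Q *m A = N *m usubmx Q.
  apply/submxP; rewrite {1}QuE -mulmxA.
  apply: submx_trans (submxMl _ _) (submx_trans Ustab _).
  by rewrite {1}UE submxMl.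
pose C := lsubmx (dsubmx Q *m A *m invmx Q).
pose D := rsubmx (dsubmx Q *m A *m invmx Q).
have QA : Q *m A = block_mx N 0 C D *m Q.
  rewrite -[X in X *m A](vsubmxK Q) mul_col_mx QuA.
  rewrite -[X in block_mx _ _ _ _ *m X](vsubmxK Q) mul_block_col mul0mx.
  by rewrite addr0 -mul_row_col hsubmxK vsubmxK mulmxKV.
have Qufree : row_free (usubmx Q).
  have /row_freeP [B UB] := Ufree.
  apply/row_freeP; exists (B *m E).
  by rewrite QuE -mulmxA (mulmxA U) UB mul1mx mulVmx.
exists (char_poly D).
  rewrite (char_poly_similar Qunit QA) char_poly_lblock.
  rewrite (@char_poly_nilpotent _ _ N k) //.
  apply: (row_free_inj Qufree); rewrite mul0mx.
  have -> : N ^+ k *m usubmx Q = usubmx Q *m A ^+ k.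
    elim: k {UAk} => [|k IH]; first by rewrite !expr0 [LHS]mul1mx [RHS]mulmx1.
    rewrite exprSr exprS -[LHS]mulmxA -QuA mulmxA IH -[LHS]mulmxA.
    by congr (_ *m _); rewrite -[LHS]exprSr exprS.
  by rewrite QuE -mulmxA UAk mulmx0.
case/row_fullP => B BUA; rewrite char_poly_det mulf_eq0 signr_eq0 /=.
rewrite -det_tr; apply/det0P => -[w w0 wD].
(* A vector killed by the second diagonal block, in the original coordinates. *)
pose c := invmx Q *m col_mx 0 w^T.
have Qc : Q *m c = col_mx 0 w^T by rewrite mulKVmx.
have Ac : A *m c = 0.
  rewrite -[A *m c](mulKmx Qunit) (mulmxA Q) QA -mulmxA Qc mul_block_col.
  by rewrite !mulmx0 mul0mx !add0r -[D]trmxK -trmx_mul wD trmx0 col_mx0 mulmx0.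
have Uc : U *m c = 0 by rewrite UE -mulmxA mul_usub_mx Qc col_mxKu mulmx0.
have c0 : c = 0.
  by rewrite -[c]mul1mx -BUA -mulmxA mul_col_mx Uc Ac col_mx0 mulmx0.
move: Qc; rewrite c0 mulmx0 -col_mx0 => /eq_col_mx [_ /(congr1 trmx)].
by rewrite trmxK trmx0 => w00; rewrite -w00 eqxx in w0.
Qed.

(** * Rank along a line of linear maps *)

(** The coordinates of the perturbed family along [X] form a matrix
    [1 + s M], whose determinant is a polynomial in [s] equal to 1 at 0. *)
Lemma free_perturb (R : numFieldType) (V : vectType R) n (X Z : 'I_n -> V) :
    free [tuple X i | i < n] ->
  exists2 p : {poly R}, p != 0 &
    forall s, p.[s] != 0 -> free [tuple X i + s *: Z i | i < n].
Proof.
move=> Xfree; pose c := coord [tuple X i | i < n].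
pose M : 'M[R]_n := \matrix_(i, j) c j (Z i).
pose p := \det (1%:M + 'X *: map_mx polyC M).
have pE s : p.[s] = \det (1%:M + s *: M).
  rewrite -[LHS]/(horner_eval _ _) -det_map_mx; congr (\det _).
  apply/matrixP => i j; rewrite !mxE /= /horner_eval.
  by rewrite !(hornerD, hornerM, hornerX, hornerC, hornerMn).
exists p => [|s ps0].
  apply/eqP => p0; have := pE 0; rewrite p0 horner0 scale0r addr0 det1.
  by move/esym/eqP; rewrite oner_eq0.
have Munit : 1%:M + s *: M \in unitmx by rewrite unitmxE -pE unitfE.
apply/freeP => k k0 i.
suff /rowP/(_ i) : \row_i k i = 0 by rewrite !mxE.
rewrite -[LHS](mulmxK Munit) (_ : _ *m (_ + _) = 0) ?mul0mx //.
apply/rowP => j; have := congr1 (c j) k0.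
rewrite /c linear0 linear_sum !mxE => k0j; rewrite -[RHS]k0j.
apply: eq_bigr => l _; rewrite -(tnth_nth 0) tnth_mktuple.
rewrite linearZ linearD linearZ /=.
rewrite !mxE; congr (_ * (_ + _)).
rewrite (_ : X l = [tuple X i | i < n]`_l) ?coord_free //.
by rewrite -(tnth_nth 0) tnth_mktuple.
Qed.

Lemma rank_perturb (R : numFieldType) (V W : vectType R) (f f0 : 'Hom(V, W))
    (U : {vspace V}) :
  exists2 p : {poly R}, p != 0 &
    forall s, p.[s] != 0 -> (\dim (f @: U) <= \dim ((f + s *: f0) @: U))%N.
Proof.
set Y := vbasis (f @: U).
have /fin_all_exists2 [X XU fX] (i : 'I_(\dim (f @: U))) :
    exists2 x, x \in U & f x = Y`_i.
  have /memv_imgP [x xU ->] : Y`_i \in (f @: U)%VS.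
    by rewrite vbasis_mem ?mem_nth ?size_tuple.
  by exists x.
have [|p p0 pfree] :=
    @free_perturb _ _ _ (fun i => f (X i)) (fun i => f0 (X i)).
  have -> : [tuple f (X i) | i < \dim (f @: U)] = Y :> seq _.
    apply: (@eq_from_nth _ 0) => [|i]; rewrite !size_tuple // => idim.
    by rewrite -[i]/(nat_of_ord (Ordinal idim)) -(tnth_nth 0) tnth_mktuple fX.
  exact: basis_free (vbasisP _).
exists p => // s /pfree sfree.
rewrite -[leqLHS](size_tuple
  [tuple f (X i) + s *: f0 (X i) | i < \dim (f @: U)]).
rewrite -(eqP sfree); apply/dimvS/span_subvP => _ /mapP [i _ ->].
by rewrite -scale_lfunE -add_lfunE memv_img.
Qed.

(** If [f] kills [u], then [s^-1 *: (f + s *: f0)] takes the value [f0 u] at [u]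
    for all [s != 0].  Replacing [f] by [f0] on the line of [u] thus gives a map
    of larger rank whose perturbations have their range in that of
    [f + s *: f0]. *)
Lemma rank_jump (R : numFieldType) (V W : vectType R) (f f0 : 'Hom(V, W)) u :
    f u = 0 -> f0 u \notin limg f ->
  exists s, (\dim (limg f) < \dim (limg (f + s *: f0)%R))%N.
Proof.
move=> fu f0u; pose pi : 'End(V) := projv <[u]>.
have fpi v : f (pi v) = 0.
  by have /vlineP [k ->] := memv_proj <[u]> v; rewrite linearZ /= fu scaler0.
pose g := f + (f0 \o pi)%VF; pose g0 := f0 - (f0 \o pi)%VF.
have [p p0 ple] := rank_perturb g g0 fullv.
have [s s0 /ple {}ple] := exists_nonroot p0; exists s.
have : (limg f + <[f0 u]> <= limg g)%VS.
  rewrite subv_add -memvE; apply/andP; split.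
    apply/subvP => _ /memv_imgP [v _ ->]; apply/memv_imgP; exists (v - pi v).
      exact: memvf.
    rewrite add_lfunE comp_lfunE !linearB /= fpi /pi projv_proj.
    by rewrite subrr addr0 subr0.
  apply/memv_imgP; exists u; rewrite ?memvf //.
  by rewrite add_lfunE comp_lfunE /pi projv_id ?memv_line // fu add0r.
move/dimvS; have : (\dim (limg f) < \dim (limg f + <[f0 u]>))%N.
  rewrite ltn_neqAle dimvS ?addvSl // andbT (dimv_leqif_eq (addvSl _ _)).
  apply: contra f0u => /eqP ->; exact: subvP (addvSr _ _) _ (memv_line _).
move=> lt1 le2; apply: leq_trans lt1 (leq_trans le2 (leq_trans ple _)).
apply/dimvS/subvP => _ /memv_imgP [v _ ->]; apply/memv_imgP.
exists (v - pi v + s^-1 *: pi v); first exact: memvf.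
rewrite !(add_lfunE, scale_lfunE, opp_lfunE, comp_lfunE).
rewrite !(linearD, linearB, linearZ) /= fpi !linearN /= fpi.
by rewrite subr0 scaler0 addr0 scalerK // -addrA [f0 (pi v) + _]addrC.
Qed.

(** Each inequality holds outside the roots of a nonzero polynomial, the first
    one near [s = 0] and the second one near [s = 1]. *)
Lemma rank_segment (R : numFieldType) (V W : vectType R) (f g : 'Hom(V, W))
    (U1 U2 : {vspace V}) :
  exists s, (\dim (f @: U1) <= \dim ((f + s *: (g - f))%R @: U1) /\
             \dim (g @: U2) <= \dim ((f + s *: (g - f))%R @: U2))%N.
Proof.
have [p p0 pP] := rank_perturb f (g - f) U1.
have [q q0 qP] := rank_perturb g (g - f) U2.
have : p * (q \Po ('X - 1%:P)) != 0.
  by rewrite mulf_neq0 // comp_poly_eq0 ?size_XsubC.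
case/exists_nonroot=> s _; rewrite hornerM mulf_eq0 negb_or => /andP[ps qs].
exists s; split; first exact: pP.
have -> : f + s *: (g - f) = g + (s - 1) *: (g - f).
  by rewrite scalerBl scale1r opprB addrCA (addrC g (f - g)) subrK addrC.
by apply: qP; rewrite horner_comp !hornerE in qs.
Qed.

(** * Lie algebra preliminaries *)

Section LieBasics.

Variables (F : fieldType) (L : lieAlgType F).
Implicit Types (x y z : L) (U V g h : {vspace L}).

Lemma lieDl x y z : lie (x + y) z = lie x z + lie y z.
Proof. by have := lie_linearl z 1 x y; rewrite /= !scale1r. Qed.

Lemma lie0l y : lie 0 y = 0.
Proof. by apply: (addIr (lie 0 y)); rewrite -lieDl !add0r. Qed.

Lemma lieZl c x y : lie (c *: x) y = c *: lie x y.
Proof. by have := lie_linearl y c x 0; rewrite /= lie0l !addr0. Qed.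

Lemma lieNl x y : lie (- x) y = - lie x y.
Proof. by rewrite -scaleN1r lieZl scaleN1r. Qed.

Lemma lieC x y : lie x y = - lie y x.
Proof.
apply/eqP; rewrite -addr_eq0; have := liexx (x + y).
by rewrite lieDl !linearD /= !liexx add0r addr0 => ->.
Qed.

Lemma lie_lie x y z : lie (lie x y) z = lie x (lie y z) - lie y (lie x z).
Proof.
have := lie_jacobi x y z; rewrite (lieC z x) linearN (lieC z) /=.
by move/eqP; rewrite subr_eq0 => /eqP <-.
Qed.

Lemma ad_linear : linear (@ad F L).
Proof.
move=> c x y; apply/lfunP => z.
by rewrite add_lfunE scale_lfunE !adE lieDl lieZl.
Qed.

HB.instance Definition _ :=
  GRing.isLinear.Build F L 'End(L) *:%R (@ad F L) ad_linear.

Lemma lie_prod_subset U V g :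
  (forall x y, x \in U -> y \in V -> lie x y \in g) -> (lie_prod U V <= g)%VS.
Proof.
move=> UVg; apply/span_subvP => _ /allpairsP [[x y] /= [xU yV ->]].
by apply: UVg; exact: vbasis_mem.
Qed.

Lemma mem_lie_centralizer g x y :
  (y \in lie_centralizer g x) = (y \in g) && (lie x y == 0).
Proof. by rewrite memv_cap memv_ker adE. Qed.

Lemma lower_central_sub h i :
  lie_subalgebra h -> (iter i (lie_prod h) h <= h)%VS.
Proof.
move=> hsub; elim: i => //= i IH; apply: lie_prod_subset => x y xh yi.
by apply: hsub => //; exact: (subvP IH).
Qed.

Definition ad_nilpotent_on (x : L) (U : {vspace L}) : Prop :=
  (forall u, u \in U -> lie x u \in U) /\
  exists n, forall u, u \in U -> iter n (lie x) u = 0.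

Lemma nilpotent_ad_nilpotent h x :
  lie_subalgebra h -> lie_nilpotent h -> x \in h -> ad_nilpotent_on x h.
Proof.
move=> hsub [n hn0] xh; split=> [u|]; first exact: hsub.
exists n => u uh; apply/eqP; rewrite -memv0 -hn0.
by elim: n {hn0} => //= n IH; exact: mem_lie_prod.
Qed.

End LieBasics.

(** * Cartan subalgebras and generic elements *)

Section NilpotentAction.

Variables (R : numFieldType) (L : lieAlgType R) (h : {vspace L}).
Hypotheses (hsub : lie_subalgebra h) (hnil : lie_nilpotent h).
Variables (W : vectType R) (sigma : L -> 'End(W)).
Hypothesis sigma_linear : linear sigma.

Local Notation central i := (iter i (lie_prod h) h).

(** Induction on [\dim V].  If [h] does not kill [V], some [y] in the last term
    of the lower central series of [h] that does not kill [V] commutes with [h]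
    on [V] and is not zero there.  The kernel and the range of [sigma y] are
    then stable, and the statement for [V] follows from the statements for
    these two spaces, since an element injective on both of them is injective
    on [V].  This takes the place of a weight decomposition, whose weights need
    not be defined over [R], and of Engel's theorem. *)
Lemma nilpotent_action (V : {vspace W}) :
    (forall x v, x \in h -> v \in V -> sigma x v \in V) ->
    (forall x y v, x \in h -> y \in h -> v \in V ->
       sigma (lie x y) v = sigma x (sigma y v) - sigma y (sigma x v)) ->
  (exists2 x, x \in h & (V :&: lker (sigma x) = 0)%VS) \/
  (exists v, [/\ v \in V, v != 0 & forall x, x \in h -> sigma x v = 0]).
Proof.
have [m] := ubnP (\dim V); elim: m V => // m IHm V.
rewrite ltnS => dimV Vst Vrep.
pose kills i := forall x v, x \in central i -> v \in V -> sigma x v = 0.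
have [n cn0] := hnil.
have kn : kills n.
  move=> x v; rewrite cn0 memv0 => /eqP -> _.
  have := sigma_linear (-1) 0 0; rewrite scaler0 addr0 scaleN1r addNr => ->.
  by rewrite zero_lfunE.
have [k0|[i ki1 nki]] : kills 0%N \/ exists2 i, kills i.+1 & ~ kills i.
    elim: n {cn0} kn => [|n IH] kn; first by left.
    by have [/IH //|nk] := EM (kills n); right; exists n.
- have [->|V0] := eqVneq V 0%VS.
    by left; exists 0; rewrite ?mem0v // cap0v.
  right; exists (vpick V); rewrite memv_pick vpick0; split=> // x xh.
  by apply: k0 => //; exact: memv_pick.
have [y [v [yi vV yv0]]] :
    exists y v, [/\ y \in central i, v \in V & sigma y v <> 0].
  apply: contrapT => nex; apply: nki => y v yi vV; apply: contrapT => yv.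
  by apply: nex; exists y, v.
have yh : y \in h := subvP (lower_central_sub i hsub) _ yi.
have comm x u : x \in h -> u \in V -> sigma x (sigma y u) = sigma y (sigma x u).
  move=> xh uV; apply/eqP; rewrite -subr_eq0 -Vrep //; apply/eqP.
  by apply: ki1 uV; exact: mem_lie_prod.
pose K := (V :&: lker (sigma y))%VS; pose J := (sigma y @: V)%VS.
have dimKJ : (\dim K + \dim J = \dim V)%N by exact: limg_ker_dim.
have JV : (J <= V)%VS by apply/subvP => _ /memv_imgP [u uV ->]; exact: Vst.
have J0 : (0 < \dim J)%N.
  rewrite lt0n dimv_eq0; apply/eqP => J0.
  by have := memv_img (sigma y) vV; rewrite -/J J0 memv0 => /eqP.
have [K0|K0] := eqVneq K 0%VS; first by left; exists y.
have dK : (0 < \dim K)%N by rewrite lt0n dimv_eq0.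
have KV : (K <= V)%VS by exact: capvSl.
have Kst x u : x \in h -> u \in K -> sigma x u \in K.
  move=> xh; rewrite !memv_cap !memv_ker => /andP[uV /eqP yu].
  by rewrite Vst // -comm // yu linear0 /=.
have Jst x u : x \in h -> u \in J -> sigma x u \in J.
  by move=> xh /memv_imgP [w wV ->]; rewrite comm // memv_img // Vst.
have [||[x0 x0h inj0]|[u [uK u0 ku]]] := IHm K _ Kst.
- by apply: leq_trans dimV; rewrite -dimKJ -addn1 leq_add2l.
- by move=> x z u xh zh uK; rewrite Vrep // (subvP KV).
- have [||[x1 x1h inj1]|[u [uJ u0 ku]]] := IHm J _ Jst.
  + by apply: leq_trans dimV; rewrite -dimKJ -add1n leq_add2r.
  + by move=> x z u xh zh uJ; rewrite Vrep // (subvP JV).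
  + left; have [s [le0 le1]] := rank_segment (sigma x0) (sigma x1) K J.
    pose x := s *: (x1 - x0) + x0.
    have xh : x \in h by rewrite memvD // memvZ // memvB.
    have sx : sigma x = sigma x0 + s *: (sigma x1 - sigma x0).
      rewrite /x sigma_linear addrC -[x1 - x0]addrC -scaleN1r sigma_linear.
      by rewrite scaleN1r [- _ + _]addrC.
    have inj (U : {vspace W}) z : (U :&: lker (sigma z) = 0)%VS ->
        (\dim (sigma z @: U) <= \dim (sigma x @: U))%N ->
        (U :&: lker (sigma x) = 0)%VS.
      move=> Uz; rewrite (limg_dim_eq Uz) -(limg_ker_dim (sigma x) U).
      by rewrite -[leqRHS]add0n leq_add2r leqn0 dimv_eq0 => /eqP.
    rewrite -sx in le0 le1.
    have injK := inj _ _ inj0 le0; have injJ := inj _ _ inj1 le1.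
    exists x => //; apply/eqP; rewrite -subv0; apply/subvP => w.
    rewrite memv_cap memv_ker => /andP[wV /eqP xw].
    have : sigma y w \in (J :&: lker (sigma x))%VS.
      by rewrite memv_cap memv_img // memv_ker comm // xw linear0 /=.
    rewrite injJ !memv0 => yw; rewrite -memv0 -injK !memv_cap !memv_ker.
    by rewrite xw eqxx wV yw.
  + by right; exists u; rewrite (subvP JV).
- by right; exists u; rewrite (subvP KV).
Qed.

End NilpotentAction.

(** The alternative of [nilpotent_action] for the action of [h] on [g / h]: a
    common null vector contradicts the fact that [h] is self-normalizing. *)
Lemma cartan_complement (R : numFieldType) (L : lieAlgType R)
    (g h : {vspace L}) :
    lie_subalgebra g -> cartan_subalgebra g h ->
  exists2 x, x \in h & (g <= h + ad x @: g)%VS.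
Proof.
move=> gsub [hg hsub hnil hself].
(* The range of [pi] is a complement of [h], in place of the quotient by [h]. *)
pose pi : 'End(L) := \1%VF - projv h.
have piE v : pi v = v - projv h v by rewrite /pi add_lfunE opp_lfunE id_lfunE.
have pi_h v : v \in h -> pi v = 0 by move=> vh; rewrite piE projv_id ?subrr.
have pi0 v : pi v = 0 -> v \in h.
  by rewrite piE => /eqP; rewrite subr_eq0 => /eqP ->; exact: memv_proj.
have pi_mod v : exists2 u, u \in h & v = u + pi v.
  by exists (projv h v); rewrite ?memv_proj // piE addrC subrK.
have pi_idem v : pi (pi v) = pi v.
  by rewrite [X in pi X = _]piE linearB /= (pi_h _ (memv_proj _ _)) subr0.
have pi_g v : v \in g -> pi v \in g.
  by move=> vg; rewrite piE memvB // (subvP hg) // memv_proj.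
pose V := (pi @: g)%VS.
have Vg : (V <= g)%VS by apply/subvP => _ /memv_imgP [v vg ->]; exact: pi_g.
have piV v : v \in V -> pi v = v.
  by case/memv_imgP=> w _ ->.
pose sigma (y : L) : 'End(L) := (pi \o ad y)%VF.
have sigmaE y v : sigma y v = pi (lie y v) by rewrite comp_lfunE adE.
have slin : linear sigma.
  move=> c x y; apply/lfunP => v; rewrite add_lfunE scale_lfunE !sigmaE.
  by rewrite lieDl lieZl linearD linearZ.
have sV y v : y \in h -> v \in V -> sigma y v \in V.
  move=> yh vV; rewrite sigmaE memv_img // gsub //; first exact: subvP hg _ yh.
  exact: subvP Vg _ vV.
have pilie y v : y \in h -> pi (lie y (pi v)) = pi (lie y v).
  move=> yh; have [u uh vE] := pi_mod v; rewrite {2}vE linearD /= linearD /=.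
  by rewrite [X in _ = X + _]pi_h ?add0r // hsub.
have srep x y v : x \in h -> y \in h -> v \in V ->
    sigma (lie x y) v = sigma x (sigma y v) - sigma y (sigma x v).
  move=> xh yh vV; rewrite !sigmaE !pilie // lie_lie linearB //.
have [[x xh inj]|[v [vV v0 kv]]] := nilpotent_action hsub hnil slin sV srep.
  exists x => //; have sVV : (sigma x @: V)%VS = V.
    apply/eqP; rewrite eqEdim limg_dim_eq // leqnn andbT.
    by apply/subvP => _ /memv_imgP [v vV ->]; exact: sV.
  apply/subvP => v vg; have [u uh ->] := pi_mod v.
  have : pi v \in (sigma x @: V)%VS by rewrite sVV memv_img.
  case/memv_imgP=> w wV ->; rewrite sigmaE.
  have [u' u'h e] := pi_mod (lie x w).
  have -> : u + pi (lie x w) = (u - u') + lie x w by rewrite {2}e addrA subrK.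
  by rewrite memv_add ?memvB // -adE memv_img // (subvP Vg).
case/negP: v0; rewrite -(piV v vV) pi_h //; apply: hself => [|y yh].
  exact: subvP Vg _ vV.
by rewrite lieC memvN; apply: pi0; rewrite -sigmaE kv.
Qed.

(** * Nullity of the adjoint representation *)

Section AdjointMatrix.

Variables (F : fieldType) (L : lieAlgType F) (g : {vspace L}).
Hypothesis gsub : lie_subalgebra g.

Local Notation e := (vbasis g).

Definition coord_row (v : L) : 'rV[F]_(\dim g) := \row_j coord (vbasis g) j v.

(** The matrix acts on coordinate rows from the right, so that products come in
    reverse order in [ad_mx_commutator]. *)
Definition ad_mx (y : L) : 'M[F]_(\dim g) :=
  \matrix_(i, j) coord (vbasis g) j (lie y (vbasis g)`_i).

Definition vspace_mx (U : {vspace L}) : 'M[F]_(\dim U, \dim g) :=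
  \matrix_(i, j) coord e j (vbasis U)`_i.

Lemma coord_row_linear : linear coord_row.
Proof. by move=> c u v; apply/rowP => j; rewrite !mxE linearP. Qed.

HB.instance Definition _ :=
  GRing.isLinear.Build F L 'rV[F]_(\dim g) *:%R coord_row coord_row_linear.

Lemma ad_mx_linear : linear ad_mx.
Proof.
by move=> c u v; apply/matrixP => i j; rewrite !mxE lieDl lieZl linearP.
Qed.

HB.instance Definition _ :=
  GRing.isLinear.Build F L 'M[F]_(\dim g) *:%R ad_mx ad_mx_linear.

Lemma coord_row_inj v : v \in g -> coord_row v = 0 -> v = 0.
Proof.
move=> vg /rowP v0; rewrite (coord_vbasis vg) big1 // => i _.
by have := v0 i; rewrite !mxE => ->; rewrite scale0r.
Qed.

Lemma coord_row_lie y v :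
  v \in g -> coord_row v *m ad_mx y = coord_row (lie y v).
Proof.
move=> vg; apply/rowP => j; rewrite !mxE [in RHS](coord_vbasis vg).
by rewrite !linear_sum; apply: eq_bigr => i _; rewrite !mxE !linearZ.
Qed.

Lemma row_ad_mx y i : row i (ad_mx y) = coord_row (lie y e`_i).
Proof. by apply/rowP => j; rewrite !mxE. Qed.

Lemma row_vspace_mx (U : {vspace L}) i :
  row i (vspace_mx U) = coord_row (vbasis U)`_i.
Proof. by apply/rowP => j; rewrite !mxE. Qed.

Lemma mem_vbasis (U : {vspace L}) (i : 'I_(\dim U)) : (vbasis U)`_i \in U.
Proof. by rewrite vbasis_mem // mem_nth // size_tuple. Qed.

Lemma ad_mx_commutator w y : w \in g -> y \in g ->
  ad_mx (lie y w) = ad_mx w *m ad_mx y - ad_mx y *m ad_mx w.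
Proof.
move=> wg yg; apply/row_matrixP => i; rewrite linearB /= !row_mul !row_ad_mx.
by rewrite !coord_row_lie ?gsub ?mem_vbasis // lie_lie linearB.
Qed.

Lemma coord_row_sub (U : {vspace L}) v :
  v \in U -> (coord_row v <= vspace_mx U)%MS.
Proof.
move=> vU; rewrite (coord_vbasis vU) linear_sum summx_sub // => i _.
by rewrite linearZ scalemx_sub //= -row_vspace_mx row_sub.
Qed.

Lemma vspace_mx_free (U : {vspace L}) : (U <= g)%VS -> row_free (vspace_mx U).
Proof.
move=> Ug; apply: inj_row_free => v vU0.
pose w := \sum_i v 0 i *: (vbasis U)`_i.
have w0 : w = 0.
  apply: coord_row_inj.
    apply: subvP Ug _ _; apply: memv_suml => i _; exact: memvZ (mem_vbasis i).
  rewrite -vU0 mulmx_sum_row linear_sum; apply: eq_bigr => i _.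
  by rewrite linearZ row_vspace_mx.
have /freeP/(_ (fun i => v 0 i) w0) v0 := basis_free (vbasisP U).
by apply/rowP => i; rewrite v0 mxE.
Qed.

(** This bounds from below the multiplicity of the eigenvalue 0 of [ad y] on [g],
    and gives its exact value when [U] and the range of [ad y] span [g]. *)
Lemma char_poly_ad_factor y (U : {vspace L}) :
    y \in g -> (U <= g)%VS -> ad_nilpotent_on y U ->
  exists2 q : {poly F}, char_poly (ad_mx y) = 'X^(\dim U) * q &
    ((g <= U + ad y @: g)%VS -> q`_0 != 0).
Proof.
move=> yg Ug [Ust [n Unil]].
have rowlie i :
    row i (vspace_mx U *m ad_mx y) = coord_row (lie y (vbasis U)`_i).
  by rewrite row_mul row_vspace_mx coord_row_lie // (subvP Ug) // mem_vbasis.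
have stab : (vspace_mx U *m ad_mx y <= vspace_mx U)%MS.
  by apply/row_subP => i; rewrite rowlie coord_row_sub // Ust // mem_vbasis.
have nilp : vspace_mx U *m ad_mx y ^+ n = 0.
  apply/row_matrixP => i; rewrite row_mul row_vspace_mx row0.
  have ui := mem_vbasis i.
  have -> : coord_row (vbasis U)`_i *m ad_mx y ^+ n =
            coord_row (iter n (lie y) (vbasis U)`_i).
    elim: n {Unil} => [|n IH]; first by rewrite expr0 [LHS]mulmx1.
    rewrite exprSr [LHS]mulmxA IH coord_row_lie //=.
    apply: subvP Ug _ _; elim: n {IH} => //= n; exact: Ust.
  by rewrite Unil // linear0.
have [q qE qP] := char_poly_factor (vspace_mx_free Ug) stab nilp.
exists q => // gle; apply: qP; rewrite -sub1mx; apply/row_subP => i.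
rewrite -addsmxE.
have -> : row i 1%:M = coord_row e`_i.
  by apply/rowP => j; rewrite !mxE coord_free ?eqxx // (basis_free (vbasisP g)).
have /memv_addP [u uU [_ /memv_imgP [w wg ->] ->]] :=
  subvP gle _ (mem_vbasis i).
rewrite linearD /= adE -coord_row_lie // addmx_sub_adds ?coord_row_sub //.
exact: submxMl.
Qed.

End AdjointMatrix.

(** The eigenvalue 0 of the adjoint representation of [g] has multiplicity at
    least [N] on the affine space [x + q].  As this space is transverse to the
    orbit of [x], the bound extends to all of [g] by [nullity_propagates], and in
    particular to [y], where the multiplicity is [\dim h]. *)
Lemma nullity_le (R : numFieldType) (L : lieAlgType R) (g q h : {vspace L})
    (x y : L) N :
    lie_subalgebra g -> x \in g -> (q <= g)%VS -> (g <= q + ad x @: g)%VS ->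
    (forall u, u \in q -> exists2 U : {vspace L},
       (U <= g)%VS /\ (N <= \dim U)%N & ad_nilpotent_on (x + u) U) ->
    y \in g -> (h <= g)%VS -> ad_nilpotent_on y h -> (g <= h + ad y @: g)%VS ->
  (N <= \dim h)%N.
Proof.
move=> gsub xg qg gle qnull yg hg hnil hle; rewrite leqNgt; apply/negP => hN.
have [p pE /(_ hle)] := char_poly_ad_factor yg hg hnil.
have -> : p`_0 = (char_poly (ad_mx g y))`_(\dim h).
  by rewrite pE coefXnM ltnn subnn.
case/eqP; pose S Z := exists2 z, z \in g & Z = ad_mx g z.
pose Q Z := exists2 u, u \in q & Z = ad_mx g u.
have -> : ad_mx g y = ad_mx g x + ad_mx g (y - x).
  by rewrite -raddfD addrC subrK.
apply: (@nullity_propagates _ _ _ N S Q) => //.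
- move=> c _ _ [z1 z1g ->] [z2 z2g ->]; exists (z1 + c *: z2).
    by rewrite memvD // memvZ.
  by rewrite linearD linearZ.
- by move=> c _ [u uq ->]; exists (c *: u); rewrite ?memvZ // linearZ.
- by exists x.
- move=> _ [z zg ->]; have /memv_addP [u uq [_ /memv_imgP [w wg ->] zE]] :=
    subvP gle _ zg.
  exists (ad_mx g w); split.
    exists u => //; rewrite -ad_mx_commutator // -raddfB /=; congr (ad_mx g _).
    by rewrite zE adE addrK.
  move=> _ [z' z'g ->]; exists (lie z' w); first exact: gsub.
  by rewrite ad_mx_commutator.
- move=> _ j [u uq ->] jN; have [U [Ug NU] Unil] := qnull u uq.
  have xug : x + u \in g by rewrite memvD // (subvP qg).
  have [p' p'E _] := char_poly_ad_factor xug Ug Unil.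
  by rewrite -raddfD p'E coefXnM (leq_trans jN NU).
by exists (y - x); rewrite // memvB.
Qed.

(** * The Killing form *)

Section Killing.

Variables (F : fieldType) (L : lieAlgType F).
Implicit Types (x y z : L) (U S : {vspace L}).

Lemma lfun_traceC (V : vectType F) (f g : 'End(V)) :
  lfun_trace (f \o g)%VF = lfun_trace (g \o f)%VF.
Proof.
by rewrite /lfun_trace !(passmx.mxof_comp _ _ (vbasisP _)) mxtrace_mulC.
Qed.

Lemma lfun_trace_linear (V : vectType F) :
  linear (@lfun_trace F V : 'End(V) -> F^o).
Proof. by move=> c f g; rewrite /lfun_trace passmx.mxof_linear linearP. Qed.

HB.instance Definition _ (V : vectType F) :=
  GRing.isLinear.Build F 'End(V) F^o *:%R (@lfun_trace F V)
    (@lfun_trace_linear V).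

Lemma ad_lie x y : ad (lie x y) = (ad x \o ad y)%VF - (ad y \o ad x)%VF.
Proof.
by apply/lfunP => z; rewrite add_lfunE opp_lfunE !comp_lfunE !adE lie_lie.
Qed.

Lemma killingC x y : killing x y = killing y x.
Proof. exact: lfun_traceC. Qed.

Lemma killing_linear x : linear (killing x : L -> F^o).
Proof.
by move=> c y z; rewrite /killing linearP comp_lfunDr -comp_lfunZr linearP.
Qed.

HB.instance Definition _ x :=
  GRing.isLinear.Build F L F^o *:%R (killing x) (killing_linear x).

Lemma killingA x y z : killing (lie x y) z = killing x (lie y z).
Proof.
rewrite /killing !ad_lie comp_lfunDl comp_lfunDr comp_lfunNl comp_lfunNr.
by rewrite !linearB /= !comp_lfunA (lfun_traceC (ad x \o ad z)%VF) comp_lfunA.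
Qed.

Lemma killing_lie_skew x y z : killing (lie x y) z = - killing y (lie x z).
Proof. by rewrite lieC killingC linearN /= killingC killingA. Qed.

(** Orthogonality to [S] amounts to [\dim S] linear equations. *)
Lemma killing_perp U S : exists2 T : {vspace L}, (\dim U <= \dim T + \dim S)%N &
  forall v, (v \in T) <-> v \in U /\ forall w, w \in S -> killing v w = 0.
Proof.
pose f (v : L) : 'rV[F]_(\dim S) := \row_i killing (vbasis S)`_i v.
have flin : linear f.
  by move=> c v w; apply/rowP => i; rewrite !mxE; exact: killing_linear.
pose fl : {linear L -> 'rV[F]_(\dim S)} :=
  HB.pack f (GRing.isLinear.Build _ _ _ _ f flin).
pose T := (U :&: lker (linfun fl))%VS; exists T.
  rewrite -(limg_ker_dim (linfun fl) U) leq_add2l.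
  by apply: leq_trans (dimvS (subvf _)) _; rewrite dimvf dim_matrix mul1r.
move=> v; rewrite memv_cap memv_ker lfunE /=; split.
  case/andP=> vU /eqP/rowP fv; split=> // w wS.
  rewrite (coord_vbasis wS) linear_sum big1 // => i _; rewrite linearZ /=.
  by have := fv i; rewrite !mxE killingC => ->; rewrite scaler0.
case=> vU vS; rewrite vU; apply/eqP/rowP => i; rewrite !mxE killingC vS //.
by rewrite vbasis_mem // mem_nth // size_tuple.
Qed.

End Killing.

(** * The compact part of a Cartan decomposition *)

Section CompactPart.

Variables (R : realType) (L : lieAlgType R) (k p : {vspace L}).
Hypothesis Ldec : cartan_decomposition k p.
Implicit Types (x y z u v w : L) (U t : {vspace L}).

Let kk x y : x \in k -> y \in k -> lie x y \in k.
Proof. by case: Ldec => _ [h _ _] _ _; exact: h. Qed.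

Let kp x y : x \in k -> y \in p -> lie x y \in p.
Proof. by case: Ldec => _ [_ h _] _ _; exact: h. Qed.

Let pp x y : x \in p -> y \in p -> lie x y \in k.
Proof. by case: Ldec => _ [_ _ h] _ _; exact: h. Qed.

Lemma killing_k_eq0 x : x \in k -> killing x x = 0 -> x = 0.
Proof.
case: Ldec => _ _ neg _ xk x0; apply/eqP; apply: contraT => /(neg x xk).
by rewrite x0 ltxx.
Qed.

Lemma killing_p_eq0 x : x \in p -> killing x x = 0 -> x = 0.
Proof.
case: Ldec => _ _ _ pos xp x0; apply/eqP; apply: contraT => /(pos x xp).
by rewrite x0 ltxx.
Qed.

Lemma cartan_split x : exists u v, [/\ u \in k, v \in p & x = u + v].
Proof.
case: Ldec => -[kpf _] _ _ _; have := memvf x; rewrite -kpf.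
by case/memv_addP=> u uk [v vp ->]; exists u, v.
Qed.

Lemma cartan_cap x : x \in k -> x \in p -> x = 0.
Proof.
case: Ldec => -[_ kp0] _ _ _ xk xp; apply/eqP.
by rewrite -memv0 -kp0 memv_cap xk.
Qed.

Lemma cartan_add_eq0 u v : u \in k -> v \in p -> u + v = 0 -> u = 0 /\ v = 0.
Proof.
move=> uk vp /eqP; rewrite addr_eq0 => /eqP uv.
have v0 : v = 0 by apply: cartan_cap => //; rewrite -[v]opprK -uv memvN.
by rewrite uv v0 oppr0.
Qed.

(** Pairing [u + v] with [u - v] separates the two components, since
    [killing u u <= 0 <= killing v v]. *)
Lemma killing_nondegenerate x : (forall y, killing x y = 0) -> x = 0.
Proof.
have [u [v [uk vp ->]]] := cartan_split x => x0.
have uv : killing u u = killing v v.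
  have := x0 (u - v); rewrite linearB /= (killingC (u + v) u).
  rewrite (killingC (u + v) v) !linearD /= (killingC v u) [X in X - _]addrC.
  by rewrite opprD addrACA subrr add0r => /subr0_eq.
have [_ _ neg pos] := Ldec.
have u0 : u = 0.
  apply: killing_k_eq0 => //; apply/eqP; rewrite eq_le.
  apply/andP; split.
    by have [->|/(neg _ uk)/ltW //] := eqVneq u 0; rewrite linear0.
  rewrite uv; have [->|/(pos _ vp)/ltW //] := eqVneq v 0; by rewrite linear0.
have v0 : v = 0 by apply: killing_p_eq0 => //; rewrite -uv u0 linear0.
by rewrite u0 v0 addr0.
Qed.

(** [ad x] preserves [k] and [p] and is skew for the Killing form, which is
    definite on each of them. *)
Lemma ad_sq_eq0 x y : x \in k -> lie x (lie x y) = 0 -> lie x y = 0.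
Proof.
move=> xk; have [u [v [uk vp ->]]] := cartan_split y.
rewrite !linearD /= => e.
have [|| xu xv] := cartan_add_eq0 _ _ e; [by rewrite !kk | by rewrite !kp |].
have norm0 w : lie x (lie x w) = 0 -> killing (lie x w) (lie x w) = 0.
  by move=> xw; rewrite killing_lie_skew xw linear0 oppr0.
rewrite (killing_k_eq0 (kk xk uk) (norm0 _ xu)).
by rewrite (killing_p_eq0 (kp xk vp) (norm0 _ xv)) addr0.
Qed.

Lemma ad_iter_eq0 x y n : x \in k -> iter n (lie x) y = 0 -> lie x y = 0.
Proof.
move=> xk; elim: n y => [|n IH] y; first by move=> /= ->; rewrite linear0.
by rewrite iterSr => /IH; exact: ad_sq_eq0.
Qed.

Lemma ad_fitting x U : x \in k -> (forall y, y \in U -> lie x y \in U) ->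
  (U <= U :&: lker (ad x) + ad x @: U)%VS.
Proof.
move=> xk Ust; have adU : (ad x @: U <= U)%VS.
  by apply/subvP => _ /memv_imgP [y yU ->]; rewrite adE Ust.
suff -> : (U :&: lker (ad x) + ad x @: U)%VS = U by [].
apply/eqP; rewrite eqEdim subv_add capvSl adU /=.
rewrite dimv_disjoint_sum ?limg_ker_dim //.
apply/eqP; rewrite -subv0; apply/subvP => w; rewrite !memv_cap memv_ker memv0.
case/andP=> /andP[_ /eqP xw] /memv_imgP [y _ wE]; rewrite wE !adE in xw *.
exact/eqP/ad_sq_eq0.
Qed.

Lemma nilpotent_sub_abelian t x y :
  (t <= k)%VS -> lie_subalgebra t -> lie_nilpotent t ->
  x \in t -> y \in t -> lie x y = 0.
Proof.
move=> tk tsub tnil xt yt.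
have [_ [n xn]] := nilpotent_ad_nilpotent tsub tnil xt.
exact: ad_iter_eq0 (subvP tk _ xt) (xn _ yt).
Qed.

Lemma semisimple_element_k x : x \in k -> semisimple_element k x.
Proof.
move=> xk; split=> //; split.
  by apply/subvP => _ /memv_imgP [y yk ->]; rewrite adE kk.
move=> W Wk Wst; have [T dimT TP] := killing_perp k W.
have Tk : (T <= k)%VS by apply/subvP => v /TP [].
have WT0 : (W :&: T)%VS = 0%VS.
  apply/eqP; rewrite -subv0; apply/subvP => w; rewrite memv_cap memv0.
  case/andP=> wW /TP [wk wperp]; apply/eqP; exact: killing_k_eq0 (wperp _ wW).
exists T; split=> //.
  apply/subvP => _ /memv_imgP [v /TP [vk vperp] ->]; rewrite adE; apply/TP.
  split=> [|w wW]; first exact: kk.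
  rewrite killing_lie_skew vperp ?oppr0 //; apply: subvP Wst _ _.
  by rewrite -adE memv_img.
apply/eqP; rewrite eqEdim subv_add Wk Tk /= dimv_disjoint_sum // addnC.
exact: dimT.
Qed.

Lemma regular_element_k x : x \in k ->
    (forall y z, y \in lie_centralizer k x -> z \in lie_centralizer k x ->
       lie y z = 0) ->
  regular_element k x.
Proof.
move=> xk abel; split; first exact: semisimple_element_k.
split; first exact: capvSl.
- by move=> y z yx zx; rewrite abel ?mem0v.
- exists 1%N; apply/eqP; rewrite -subv0; apply: lie_prod_subset => y z yx zx.
  by rewrite abel ?mem0v.
move=> y yk ynorm; rewrite mem_lie_centralizer yk; apply/eqP.
apply: ad_sq_eq0 => //; have := ynorm x; rewrite !mem_lie_centralizer xk liexx.
rewrite eqxx => /(_ isT) /andP[_ /eqP xyx].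
by rewrite [lie x y]lieC linearN /= xyx oppr0.
Qed.

Lemma center_semisimple_eq0 z : lie_semisimple k ->
  z \in k -> (forall x, x \in k -> lie x z = 0) -> z = 0.
Proof.
move=> [_ kss] zk zc; apply/eqP; rewrite -memv0 -(kss <[z]>%VS) ?memv_line //.
  split=> [|x _ xk /vlineP [c ->]]; first by rewrite -memvE.
  by rewrite linearZ /= zc // scaler0 mem0v.
exists 1%N; apply/eqP; rewrite -subv0; apply: lie_prod_subset.
move=> _ _ /vlineP [c ->] /vlineP [d ->].
by rewrite lieZl linearZ /= liexx !scaler0 mem0v.
Qed.

(** While a nonzero [h] in [t] commutes with [b], some [y] in [[a, k]] does not
    commute with [h], for otherwise [h] would be central in [k].  The element
    [b + [h, y]] is then better than [b]: the kernel and the range of [ad h] are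
    independent and stable under [t], so that an element of [t] commutes with
    [b + [h, y]] only if it commutes with [b] and with [[h, y]], and [h] does
    not commute with [[h, y]]. *)
Lemma transversal_in_range a : lie_semisimple k -> a \in k ->
    (forall y z, y \in lie_centralizer k a -> z \in lie_centralizer k a ->
       lie y z = 0) ->
  exists2 b, b \in (ad a @: k)%VS &
    (lie_centralizer k a :&: lker (ad b))%VS = 0%VS.
Proof.
move=> kss ak; set t := lie_centralizer k a => tab.
have tk x : x \in t -> x \in k by rewrite mem_lie_centralizer => /andP[].
have ta x : x \in t -> lie x a = 0.
  by rewrite mem_lie_centralizer => /andP[_ /eqP ax]; rewrite lieC ax oppr0.
suff step n b : b \in (ad a @: k)%VS -> (\dim (t :&: lker (ad b)) < n)%N ->
    exists2 b', b' \in (ad a @: k)%VS & (t :&: lker (ad b'))%VS = 0%VS.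
  exact: step 0 (mem0v _) (ltnSn _).
elim: n b => // n IH b bm; rewrite ltnS => dimb.
have [c0|] := eqVneq (t :&: lker (ad b))%VS 0%VS; first by exists b.
rewrite -vpick0; set h := vpick _ => h0.
have := memv_pick (t :&: lker (ad b)); rewrite -/h memv_cap memv_ker adE.
case/andP=> ht /eqP bh; have hk := tk h ht.
have hb : lie h b = 0 by rewrite lieC bh oppr0.
have [y ym hy] : exists2 y, y \in (ad a @: k)%VS & lie h y <> 0.
  apply: contrapT => nex; case/negP: h0; apply/eqP.
  apply: center_semisimple_eq0 => // x xk; rewrite lieC; apply/eqP.
  rewrite oppr_eq0; apply/eqP.
  have /memv_addP [u uc [w wm ->]] :=
    subvP (ad_fitting ak (fun y => @kk a y ak)) _ xk.
  rewrite linearD /= tab // add0r; apply: contrapT => hw.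
  by apply: nex; exists w.
have hm x z : x \in t -> z \in (ad a @: k)%VS -> lie x z \in (ad a @: k)%VS.
  move=> xt /memv_imgP [w wk ->]; rewrite adE.
  have -> : lie x (lie a w) = lie a (lie x w).
    by apply: subr0_eq; rewrite -lie_lie (ta x xt) lie0l.
  by rewrite -adE memv_img // kk // tk.
pose c := lie h y.
have hc : lie h c <> 0 by move/(ad_sq_eq0 hk).
apply: (IH (b + c)%R); first by rewrite memvD // hm.
apply: leq_trans dimb.
have comm x z : x \in t -> lie h (lie x z) = lie x (lie h z).
  by move=> xt; apply: subr0_eq; rewrite -lie_lie (tab h x) ?lie0l.
have sub : (t :&: lker (ad (b + c)%R) <= t :&: lker (ad b))%VS.
  apply/subvP => x /memv_capP [xt]; rewrite memv_ker adE lieDl addr_eq0.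
  move=> /eqP bx; apply/memv_capP; split=> //; rewrite memv_ker adE; apply/eqP.
  have xb : lie x b = - lie h (lie x y).
    by rewrite comm // -/c (lieC x b) bx opprK; exact: lieC.
  have hxb : lie h (lie x b) = 0 by rewrite comm // hb linear0.
  have : lie h (lie x y) = 0.
    apply: ad_sq_eq0 => //; apply/eqP; rewrite -oppr_eq0 -linearN -xb.
    exact/eqP.
  by move=> hxy; rewrite lieC xb hxy oppr0 oppr0.
rewrite ltn_neqAle (dimv_leqif_eq sub) (dimvS sub) andbT; apply/eqP => e.
have : h \in (t :&: lker (ad (b + c)%R))%VS
  by rewrite e; apply/memv_capP; rewrite memv_ker adE bh.
case/memv_capP=> _; rewrite memv_ker adE lieDl bh add0r lieC oppr_eq0 => /eqP.
exact: hc.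
Qed.

Section Tangent.

Variables (a b : L).
Hypotheses (ak : a \in k) (bk : b \in k) (ab0 : killing a b = 0).
Hypothesis b_max : forall z, z \in k -> killing a z = 0 ->
  (\dim (limg (ad z)) <= \dim (limg (ad b)))%N.
Hypothesis ab_transversal : (lie_centralizer k a :&: lker (ad b))%VS = 0%VS.

(** The tangent condition at a point of maximal rank: [ad z] maps the kernel of
    [ad b] into its range. *)
Lemma tangent_orthogonal z u v : z \in k -> killing a z = 0 ->
  lie b u = 0 -> lie b v = 0 -> killing z (lie u v) = 0.
Proof.
move=> zk az bu bv; have [] := boolP (ad z u \in limg (ad b)).
  case/memv_imgP=> y _; rewrite !adE => zu.
  by rewrite -killingA zu killing_lie_skew bv linear0 oppr0.
move=> zu; have [|s] := rank_jump _ zu; first by rewrite adE.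
have le : (\dim (limg (ad (b + s *: z)%R)) <= \dim (limg (ad b)))%N.
  apply: b_max; first by rewrite memvD // memvZ.
  by rewrite linearD linearZ /= ab0 az scaler0 addr0.
by rewrite ltnNge -linearZ -linearD le.
Qed.

(** Being orthogonal to all of [V], the bracket [c] lies on the line of [a],
    hence in [t]; it also commutes with [b]. *)
Lemma centralizer_bracket u v :
  lie b u = 0 -> lie b v = 0 -> lie u v \in k -> lie u v = 0.
Proof.
move=> bu bv; set c := lie u v => ck.
(* The component of [c] orthogonal to [a]; when [a = 0] the quotient is 0 and
   this is [c] itself. *)
pose z := c - (killing a c / killing a a) *: a.
have zk : z \in k by rewrite memvB // memvZ.
have az : killing a z = 0.
  rewrite linearB linearZ /= /z; have [a0|a0] := eqVneq (killing a a) 0.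
    by rewrite a0 scaler0 subr0 (killing_k_eq0 ak a0) killingC linear0.
  by rewrite [_ *: _]divfK // subrr.
have zz : killing z z = 0.
  rewrite {2}/z linearB linearZ /= [killing z a]killingC az scaler0 subr0.
  exact: tangent_orthogonal.
have cE : c = (killing a c / killing a a) *: a.
  exact/subr0_eq/(killing_k_eq0 zk zz).
apply/eqP; rewrite -memv0 -ab_transversal memv_cap memv_ker adE.
rewrite mem_lie_centralizer ck {1}cE linearZ /= liexx scaler0 eqxx /=.
have := lie_lie b u v; rewrite bu lie0l bv linear0 subr0.
by move=> <-.
Qed.

Lemma centralizer_k_abelian y z :
  y \in lie_centralizer k b -> z \in lie_centralizer k b -> lie y z = 0.
Proof.
rewrite !mem_lie_centralizer => /andP[yk /eqP by0] /andP[zk /eqP bz].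
by apply: centralizer_bracket => //; exact: kk.
Qed.

(** With [w = [y, v]], [killing w w] is [killing y [v, w]], and [[v, w]] is zero
    by [centralizer_bracket]. *)
Lemma centralizer_k_p_commute y v :
  y \in lie_centralizer k b -> v \in p -> lie b v = 0 -> lie y v = 0.
Proof.
rewrite mem_lie_centralizer => /andP[yk /eqP by0] vp bv.
have wp := kp yk vp; apply: killing_p_eq0 => //.
rewrite killingA centralizer_bracket ?linear0 //; last exact: pp.
have := lie_lie b y v; rewrite by0 lie0l bv linear0 subr0.
by move=> <-.
Qed.

Lemma ker_ad_split y : lie b y = 0 -> exists u v,
  [/\ u \in lie_centralizer k b, v \in p, lie b v = 0 & y = u + v].
Proof.
have [u [v [uk vp ->]]] := cartan_split y; rewrite linearD /= => e.
have [bu bv] := cartan_add_eq0 (kk bk uk) (kp bk vp) e.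
by exists u, v; split=> //; rewrite mem_lie_centralizer uk bu eqxx.
Qed.

Let t := lie_centralizer k b.

Let tk : (t <= k)%VS. Proof. exact: capvSl. Qed.

(** [y] kills [t] and one more vector outside [k]: itself, or [v] when [y] is in
    [t]. *)
Lemma ker_ad_nilpotent_sub v y : v \in p -> v != 0 -> lie b v = 0 ->
    lie b y = 0 ->
  exists2 U : {vspace L}, (\dim t < \dim U)%N &
    forall w, w \in U -> lie y w = 0.
Proof.
move=> vp v0 bv by0.
have [y1 [y2 [y1t y2p by2 yE]]] := ker_ad_split by0.
have yt w : w \in t -> lie y w = 0.
  move=> wt; rewrite yE lieDl centralizer_k_abelian // add0r lieC.
  by rewrite centralizer_k_p_commute ?oppr0.
have [w wk yw] : exists2 w, w \notin k & lie y w = 0.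
  have [y20|y20] := eqVneq y2 0.
    exists v; last by rewrite yE y20 addr0 centralizer_k_p_commute.
    by apply: contra v0 => vk; rewrite (cartan_cap vk vp).
  exists y; last exact: liexx.
  apply: contra y20 => yk; apply/eqP/cartan_cap => //.
  have -> : y2 = y - y1 by rewrite yE addrAC subrr add0r.
  by rewrite memvB // (subvP tk).
exists (t + <[w]>)%VS; last first.
  move=> _ /memv_addP [u ut [_ /vlineP [c ->] ->]].
  by rewrite linearD linearZ /= yw scaler0 addr0 yt.
rewrite ltn_neqAle dimvS ?addvSl // andbT (dimv_leqif_eq (addvSl _ _)).
apply: contra wk => /eqP tw; apply: subvP tk _ _; rewrite tw.
exact: subvP (addvSr _ _) _ (memv_line _).
Qed.

Hypothesis full_rank : lie_rank k = lie_rank (fullv : {vspace L}).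

(** A nonzero [v] would give all the elements of [L] a nullity larger than
    [\dim t], by [ker_ad_nilpotent_sub] and [nullity_le], and so larger than the
    rank of [k]. *)
Lemma full_rank_centralizer v : v \in p -> lie b v = 0 -> v = 0.
Proof.
move=> vp bv; have ksub : lie_subalgebra k by exact: kk.
have b_regular := regular_element_k bk centralizer_k_abelian.
have bt : ad_nilpotent_on b t.
  have bt0 u : u \in t -> lie b u = 0.
    by rewrite mem_lie_centralizer => /andP[_ /eqP].
  by split=> [u ut|]; [rewrite bt0 ?mem0v | exists 1%N].
have kt : (k <= t + ad b @: k)%VS by apply: ad_fitting => // y; exact: kk.
have [h hC dimh] : exists2 h : {vspace L}, cartan_subalgebra k h &
    \dim h = lie_rank k.
  apply: (@xgetPex _ 0%N [set n |
    exists2 h : {vspace L}, cartan_subalgebra k h & \dim h = n]%classic).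
  by exists (\dim t), t => //; case: b_regular.
have h_le_t : (\dim h <= \dim t)%N.
  have [x xh kx] := cartan_complement ksub hC.
  have [hk hsub hnil _] := hC.
  apply: (nullity_le (g := k) (q := h) (x := x) (y := b)) => //.
    exact: subvP hk _ xh.
  move=> u uh; exists h; first by split.
  by apply: nilpotent_ad_nilpotent => //; rewrite memvD.
apply: contrapT => /eqP v0.
have fsub : lie_subalgebra (fullv : {vspace L}) by move=> x y _ _; exact: memvf.
(* Were there no Cartan subalgebra in [L], the rank of [L], hence of [k], would
   be 0 by convention; this forces [k = 0] and makes [p] abelian. *)
have [[hL hLC]|noC] := EM (exists hL : {vspace L}, cartan_subalgebra fullv hL).
  have [hL' hLC' dimhL] : exists2 h : {vspace L}, cartan_subalgebra fullv h &
      \dim h = lie_rank (fullv : {vspace L}).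
    apply: (@xgetPex _ 0%N [set n |
      exists2 h : {vspace L}, cartan_subalgebra fullv h & \dim h = n]%classic).
    by exists (\dim hL), hL.
  have [x xh Lx] := cartan_complement fsub hLC'.
  have [_ hsub hnil _] := hLC'.
  suff : (\dim t < \dim hL')%N.
    by rewrite dimhL -full_rank -dimh ltnNge h_le_t.
  apply: (nullity_le (g := fullv) (q := lker (ad b)) (x := b) (y := x)) => //.
  - exact: memvf.
  - exact: subvf.
  - by have := @ad_fitting b fullv bk (fun y _ => memvf _); rewrite capfv.
  - move=> u; rewrite memv_ker adE => /eqP bu.
    have [|U dimU yU] := @ker_ad_nilpotent_sub v (b + u) vp v0 bv.
      by rewrite linearD /= liexx bu addr0.
    exists U; first by rewrite subvf.
    by split=> [w wU|]; [rewrite yU ?mem0v | exists 1%N].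
  - exact: memvf.
  - exact: subvf.
  - exact: nilpotent_ad_nilpotent.
have h0 : \dim h = 0%N.
  rewrite dimh full_rank; apply: xgetPN => n [hL hLC _].
  by apply: noC; exists hL.
have k0 x : x \in k -> x = 0.
  move=> xk; apply/eqP; rewrite -memv0.
  have hE : h = 0%VS by apply/eqP; rewrite -dimv_eq0 h0.
  have [_ _ _ hself] := hC; rewrite -hE; apply: hself => // y.
  by rewrite hE memv0 => /eqP ->; rewrite linear0 mem0v.
case/negP: v0; apply/eqP/killing_p_eq0 => //.
have adv : ad v = 0.
  apply/lfunP => y; rewrite adE zero_lfunE.
  have [y1 [y2 [y1k y2p ->]]] := cartan_split y.
  by rewrite (k0 _ y1k) add0r; exact/k0/pp.
by rewrite /killing adv comp_lfun0l linear0.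
Qed.

(** The orthogonal of the left-hand side is the common centralizer of [a] and
    [b]. *)
Lemma range_sum_full : (limg (ad a) + limg (ad b))%VS = fullv.
Proof.
set S := (_ + _)%VS; have [T dimT TP] := killing_perp fullv S.
suff T0 : T = 0%VS.
  by apply/eqP; rewrite eqEdim subvf; rewrite T0 dimv0 add0n in dimT.
apply/eqP; rewrite -subv0; apply/subvP => v /TP [_ vS].
have ker x : (limg (ad x) <= S)%VS -> lie x v = 0.
  move=> xS; apply: killing_nondegenerate => y; rewrite lieC killingC.
  rewrite linearN /= killingC killingA vS ?oppr0 // -adE.
  by apply: subvP xS _ _; exact: memv_img (memvf _).
have av := ker a (addvSl _ _); have bv := ker b (addvSr _ _).
have [v1 [v2 [v1t v2p bv2 vE]]] := ker_ad_split bv.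
rewrite (full_rank_centralizer v2p bv2) addr0 in vE.
rewrite -ab_transversal memv_cap memv_ker adE bv eqxx andbT.
by rewrite mem_lie_centralizer av eqxx andbT vE (subvP tk).
Qed.

End Tangent.

End CompactPart.

Theorem corollary1p7 (R : realType) (L : lieAlgType R) (k p : {vspace L})
    (L_semisimple : lie_semisimple (fullv : {vspace L}))
    (L_cartan : cartan_decomposition k p)
    (k_semisimple : lie_semisimple k)
    (full_rank : lie_rank k = lie_rank (fullv : {vspace L}))
    (a : L) (a_regular : regular_element k a) :
  exists b : L,
    [/\ regular_element k b,
        (fullv : {vspace L}) = (limg (ad a) + limg (ad b))%VS &
        killing a b = 0].
Proof.
have [[ak _] [tk tsub tnil _]] := a_regular.
have tab y z := nilpotent_sub_abelian L_cartan tk tsub tnil (x := y) (y := z).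
have [b2 b2a b2t] := transversal_in_range L_cartan k_semisimple ak tab.
have [b2k ab2] : b2 \in k /\ killing a b2 = 0.
  case/memv_imgP: b2a => y yk ->; rewrite adE; split.
    by case: L_cartan => _ [kk _ _] _ _; exact: kk.
  by rewrite -killingA liexx killingC linear0.
pose rk n :=
  `[< exists z, [/\ z \in k, killing a z = 0 & \dim (limg (ad z)) = n] >].
have rk_ex : exists n, rk n.
  by exists (\dim (limg (ad b2))); apply/asboolP; exists b2.
have rk_ub n : rk n -> (n <= dim L)%N.
  by move=> /asboolP [z [_ _ <-]]; rewrite -dimvf dimvS ?subvf.
case: (ex_maxnP rk_ex rk_ub) => m /asboolP [b1 [b1k ab1 b1m]] m_max.
have [s [le1 le2]] := rank_segment (ad b1) (ad b2) fullv (lie_centralizer k a).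
set b := b1 + s *: (b2 - b1).
have bE : ad b1 + s *: (ad b2 - ad b1) = ad b.
  by rewrite /b (linearD (@ad R L)) linearZ /= [ad (b2 - b1)]linearB.
rewrite bE in le1 le2.
have bk : b \in k by rewrite memvD // memvZ // memvB.
have ab : killing a b = 0.
  rewrite /b linearD linearZ /= [killing a (b2 - b1)]linearB /= ab1 ab2.
  by rewrite subrr scaler0 addr0.
have b_max z : z \in k -> killing a z = 0 ->
    (\dim (limg (ad z)) <= \dim (limg (ad b)))%N.
  move=> zk az; apply: leq_trans le1; rewrite b1m; apply: m_max.
  by apply/asboolP; exists z.
have bt : (lie_centralizer k a :&: lker (ad b))%VS = 0%VS.
  move: le2; rewrite (limg_dim_eq b2t) -(limg_ker_dim (ad b)).
  by rewrite -[leqRHS]add0n leq_add2r leqn0 dimv_eq0 => /eqP.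
exists b; split=> //.
  apply: (regular_element_k L_cartan bk).
  exact: (centralizer_k_abelian L_cartan ak bk ab b_max bt).
exact/esym/(range_sum_full L_cartan ak bk ab b_max bt full_rank).
Qed.
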